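(* Let $n\ge2$, $\alpha\in(0,1)$, and let $\mathbf X=(X_1,\dots,X_n)$ be the contaminated sequence described in the context, whose underlying clean sequence $\widetilde{\mathbf X}$ is split-exchangeable (in the sense defined in the context) at the true changepoint $\xi\in\{1,\dots,n-1\}$. For arbitrary fixed measurable score functions $S_t:\mathcal X^n\to\mathbb R$, $t=1,\dots,n-1$, the CONCH set $\mathcal C_\alpha(\mathbf X)$ defined in the context satisfies $$\Pr\bigl(\xi\in\mathcal C_\alpha(\mathbf X)\bigr)\ge1-\alpha .$$
   Context: Data model. $\mathcal X$ is the observation space, and $\xi\in\{1,\dots,n-1\}$ is a fixed unknown index. The clean sequence $\widetilde{\mathbf X}=(\widetilde X_1,\dots,\widetilde X_n)\in\mathcal X^n$ is split-exchangeable at $\xi$, meaning that its pre-change and post-change segments are each exchangeable: $$(\widetilde X_1,\dots,\widetilde X_\xi)\overset{d}{=}(\widetilde X_{\pi_0(1)},\dots,\widetilde X_{\pi_0(\xi)}),\qquad (\widetilde X_{\xi+1},\dots,\widetilde X_n)\overset{d}{=}(\widetilde X_{\pi_1(\xi+1)},\dots,\widetilde X_{\pi_1(n)})$$ for arbitrary permutations $\pi_0$ of $\{1,\dots,\xi\}$ and $\pi_1$ of $\{\xi+1,\dots,n\}$. Contamination: $Y_1,\dots,Y_n$ are i.i.d. $\mathrm{Bernoulli}(\varepsilon)$ with $\varepsilon\in(0,1)$, $Z_1,\dots,Z_n$ are i.i.d. from a distribution $Q$ on $\mathcal X$, and $\widetilde{\mathbf X}$, $(Y_i)_i$, $(Z_i)_i$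 are mutually independent. The observation is $X_i=(1-Y_i)\widetilde X_i+Y_iZ_i$, i.e. $X_i=\widetilde X_i$ if $Y_i=0$ and $X_i=Z_i$ if $Y_i=1$. CONCH set. For $t\in\{1,\dots,n-1\}$, $\Pi_t$ denotes the set of all permutations $\pi$ of $\{1,\dots,n\}$ that map $\{1,\dots,t\}$ to itself and $\{t+1,\dots,n\}$ to itself, and $\pi(\mathbf x)=(x_{\pi(1)},\dots,x_{\pi(n)})$. Put $p_t(\mathbf X)=\frac1{|\Pi_t|}\sum_{\pi\in\Pi_t}\mathbf 1\bigl[S_t(\pi(\mathbf X))\le S_t(\mathbf X)\bigr]$ and $\mathcal C_\alpha(\mathbf X)=\{t\in\{1,\dots,n-1\}:p_t(\mathbf X)>\alpha\}$.
   Formalization: Split-exchangeability is required jointly: the pair of pre- and post-change segments keeps its law when both are permuted. With each segment only separately exchangeable the claim fails, e.g. n=4, ξ=2, clean sequence (0,1,0,1) or (1,0,1,0) with probability 1/2 each, small ε. *)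

(* Defs.v *)
From HB Require Import structures.
From mathcomp Require Export all_boot all_order all_fingroup all_algebra.
From mathcomp Require Export all_classical all_reals all_analysis.
Export Order.TTheory GRing.Theory Num.Theory.
Export numFieldNormedType.Exports.
Set Implicit Arguments.
Unset Strict Implicit.
Unset Printing Implicit Defensive.
Local Open Scope classical_set_scope.
Local Open Scope ring_scope.

(* Positions are numbered from 0: position i here is position i + 1 in the
   usual numbering, so that {1, ..., t} is [set i | i < t]. *)

Definition permute (T : Type) (k : nat) (p : 'S_k) (x : k.-tuple T) :
    k.-tuple T :=
  [tuple tnth x (p i) | i < k].

Definition segments (T : Type) (n xi : nat) (x : n.-tuple T) :
    (minn xi n).-tuple T * (n - xi).-tuple T :=
  ([tuple of take xi x], [tuple of drop xi x]).

Definition eq_in_law (d d' : measure_display) (Om : measurableType d)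
    (E : measurableType d') (R : realType) (P : probability Om R)
    (U V : Om -> E) : Prop :=
  forall A : set E, measurable A -> P (U @^-1` A) = P (V @^-1` A).

(* The equalities in distribution of the two segments are required jointly,
   i.e. for the pair (pre-change segment, post-change segment).  Taking
   A `*` setT and setT `*` A recovers the exchangeability of each segment;
   the latter alone does not constrain the dependence between the segments. *)
Definition split_exchangeable (d d' : measure_display) (Om : measurableType d)
    (E : measurableType d') (R : realType) (P : probability Om R) (n xi : nat)
    (X : Om -> n.-tuple E) : Prop :=
  forall (p0 : 'S_(minn xi n)) (p1 : 'S_(n - xi)),
    eq_in_law P
      (fun w => segments xi (X w))
      (fun w => (permute p0 (segments xi (X w)).1,
                 permute p1 (segments xi (X w)).2)).

(* The product rule for subfamilies is the case A i = setT for some i. *)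
Definition mutually_independent (d d' : measure_display)
    (Om : measurableType d) (E : measurableType d') (R : realType)
    (P : probability Om R) (n : nat) (V : Om -> n.-tuple E) : Prop :=
  forall A : 'I_n -> set E, (forall i, measurable (A i)) ->
    P (\bigcap_(i in [set: 'I_n]) [set w | A i (tnth (V w) i)]) =
    (\prod_(i < n) P [set w | A i (tnth (V w) i)])%E.

Definition iid (d d' : measure_display) (Om : measurableType d)
    (E : measurableType d') (R : realType) (P : probability Om R)
    (mu : probability E R) (n : nat) (V : Om -> n.-tuple E) : Prop :=
  mutually_independent P V /\
  (forall (i : 'I_n) (A : set E), measurable A ->
     P [set w | A (tnth (V w) i)] = mu A).

Definition independent3 (d d1 d2 d3 : measure_display) (Om : measurableType d)
    (E1 : measurableType d1) (E2 : measurableType d2) (E3 : measurableType d3)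
    (R : realType) (P : probability Om R)
    (U : Om -> E1) (V : Om -> E2) (W : Om -> E3) : Prop :=
  forall (A : set E1) (B : set E2) (C : set E3),
    measurable A -> measurable B -> measurable C ->
    P (U @^-1` A `&` V @^-1` B `&` W @^-1` C) =
    (P (U @^-1` A) * P (V @^-1` B) * P (W @^-1` C))%E.

Definition contaminate (T : Type) (n : nat) (x : n.-tuple T)
    (y : n.-tuple bool) (z : n.-tuple T) : n.-tuple T :=
  [tuple if tnth y i then tnth z i else tnth x i | i < n].

Definition split_perms (n t : nat) : {set 'S_n} :=
  [set p : 'S_n |
    (p @: [set i : 'I_n | (i < t)%N] == [set i : 'I_n | (i < t)%N]) &&
    (p @: [set i : 'I_n | (t <= i)%N] == [set i : 'I_n | (t <= i)%N])]%SET.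

Definition conch_pvalue (T : Type) (R : realType) (n : nat)
    (S : nat -> n.-tuple T -> R) (t : nat) (x : n.-tuple T) : R :=
  (#|split_perms n t|%:R)^-1 *
  \sum_(p in split_perms n t) ((S t (permute p x) <= S t x)%R : nat)%:R.

Definition conch_set (T : Type) (R : realType) (n : nat)
    (S : nat -> n.-tuple T -> R) (alpha : R) (x : n.-tuple T) : set nat :=
  [set t | (0 < t < n)%N /\ alpha < conch_pvalue S t x].

(* Main.v *)
(** Contamination commutes with permuting positions.  As the clean sequence is
   split-exchangeable and [Y], [Z] are i.i.d., every split permutation leaves
   the laws of [Xt], [Y] and [Z] unchanged; by independence it leaves their
   joint law unchanged, hence also the law of [X].  So the probability that the
   p-value of [X] is at most [alpha] is the expected proportion of split
   permutations [q] such that the p-value of [q(X)] is at most [alpha], and this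
   proportion never exceeds [alpha]. *)
From HB Require Import structures.
Require Import Defs.
From mathcomp Require Import measurable_realfun zify.
Set Implicit Arguments.
Unset Strict Implicit.
Unset Printing Implicit Defensive.
Local Open Scope classical_set_scope.
Local Open Scope ring_scope.

(** * The group of split permutations and its action on sequences *)

Lemma split_permsP (n t : nat) (p : 'S_n) :
  reflect (forall i, (p i < t)%N = (i < t)%N) (p \in split_perms n t).
Proof.
apply: (iffP idP) => [|pt].
  rewrite inE => /andP[/eqP p_lt /eqP p_ge] i; case: (ltnP i t) => it.
    have : p i \in p @: [set j : 'I_n | (j < t)%N]%SET.
      by apply: imset_f; rewrite inE.
    by rewrite p_lt inE.
  have : p i \in p @: [set j : 'I_n | (t <= j)%N]%SET.
    by apply: imset_f; rewrite inE.
  by rewrite p_ge inE leqNgt => /negbTE.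
rewrite inE; apply/andP; split;
  (* As [p] is injective, comparing cardinalities reduces each equality of sets to one inclusion. *)
  rewrite eqEcard (card_imset _ (@perm_inj _ p)) leqnn andbT;
  apply/fintype.subsetP => _ /imsetP[i + ->]; rewrite !inE; first by rewrite pt.
by rewrite leqNgt -(pt i) -leqNgt.
Qed.

Lemma split_permsM (n t : nat) (p q : 'S_n) :
  p \in split_perms n t -> q \in split_perms n t ->
  (p * q)%g \in split_perms n t.
Proof.
move=> /split_permsP pt /split_permsP qt; apply/split_permsP => i.
by rewrite permM qt pt.
Qed.

Lemma split_permsV (n t : nat) (p : 'S_n) :
  p \in split_perms n t -> (p^-1)%g \in split_perms n t.
Proof.
move=> /split_permsP pt; apply/split_permsP => i.
by rewrite -{2}(permKV p i) pt.
Qed.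

Lemma split_perms1 (n t : nat) : (1%g : 'S_n) \in split_perms n t.
Proof. by apply/split_permsP => i; rewrite perm1. Qed.

(** No reversal of order: the product of ['S_n] applies its left factor first, and position [i] of
    the left-hand side is read through [p], then through [q]. *)
Lemma permuteM (T : Type) (n : nat) (p q : 'S_n) (x : n.-tuple T) :
  permute p (permute q x) = permute (p * q) x.
Proof. by apply: eq_from_tnth => i; rewrite !tnth_mktuple permM. Qed.

Lemma permute_contaminate (T : Type) (n : nat) (p : 'S_n) (x z : n.-tuple T)
    (y : n.-tuple bool) :
  permute p (contaminate x y z) =
  contaminate (permute p x) (permute p y) (permute p z).
Proof. by apply: eq_from_tnth => i; rewrite !tnth_mktuple. Qed.

(** * The p-value along an orbit of split permutations *)

Lemma conch_pvalue_permute (T : Type) (R : realType) (n t : nat)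
    (S : nat -> n.-tuple T -> R) (q : 'S_n) (x : n.-tuple T) :
  q \in split_perms n t ->
  conch_pvalue S t (permute q x) =
  (#|split_perms n t|%:R)^-1 *
  \sum_(p in split_perms n t)
    ((S t (permute p x) <= S t (permute q x))%R : nat)%:R.
Proof.
move=> qt; congr (_ * _).
(* Right multiplication by [q] is a bijection of the split permutations, so every point of the orbit
   is ranked among the same family of scores. *)
rewrite [RHS](reindex_inj (mulIg q)) /=; apply: eq_big => [p|p _].
  apply/idP/idP => [pt|/split_permsM/(_ (split_permsV qt))].
    exact: split_permsM.
  by rewrite mulgK.
by rewrite permuteM.
Qed.

(* Among the permutations with p-value at most alpha, take one of maximal
   score: its p-value counts all of them. *)
Lemma sum_conch_pvalue_le (T : Type) (R : realType) (n t : nat)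
    (S : nat -> n.-tuple T -> R) (alpha : R) (x : n.-tuple T) :
  0 <= alpha ->
  \sum_(q in split_perms n t)
    ((conch_pvalue S t (permute q x) <= alpha)%R : nat)%:R
  <= alpha * #|split_perms n t|%:R.
Proof.
move=> a0; set G := split_perms n t.
have G0 : 0 < #|G|%:R :> R.
  by rewrite ltr0n; apply/card_gt0P; exists 1%g; exact: split_perms1.
pose B q := (q \in G) && (conch_pvalue S t (permute q x) <= alpha)%R.
have [/existsP[q0 Bq0]|] := boolP [exists q, B q]; last first.
  move=> /existsPn nB; rewrite big1 ?mulr_ge0 ?ler0n// => q qG.
  by have := nB q; rewrite /B qG /= => /negbTE ->.
case: (@arg_maxP _ _ _ q0 B (fun q => S t (permute q x)) Bq0) => q Bq qmax.
case/andP: (Bq) => qG; rewrite conch_pvalue_permute// -/G mulrC ler_pdivrMr//.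
apply: le_trans; apply: ler_sum => p pG; rewrite ler_nat.
have [pa|//] := boolP (conch_pvalue S t (permute p x) <= alpha).
by rewrite lt0b; apply: qmax; rewrite /B pG.
Qed.

(** * Measurability, and generators of a sigma-algebra *)

Section measurability.
Context d (E : measurableType d).

Lemma measurable_permute (n : nat) (p : 'S_n) :
  measurable_fun [set: n.-tuple E] (permute p).
Proof.
apply/measurable_fun_tnthP => i.
rewrite (_ : _ \o _ = @tnth _ E ^~ (p i)); first exact: measurable_tnth.
by apply/funext => x /=; rewrite tnth_mktuple.
Qed.

Lemma measurable_contaminate (n : nat) :
  measurable_fun [set: n.-tuple E * (n.-tuple bool * n.-tuple E)]
    (fun w => contaminate w.1 w.2.1 w.2.2).
Proof.
apply/measurable_fun_tnthP => i.
rewrite (_ : _ \o _ = fun w : n.-tuple E * (n.-tuple bool * n.-tuple E) =>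
    if tnth w.2.1 i then tnth w.2.2 i else tnth w.1 i); last first.
  by apply/funext => w /=; rewrite tnth_mktuple.
apply: measurable_fun_ifT.
- apply: (measurableT_comp (measurable_tnth i)).
  exact: (measurableT_comp measurable_fst measurable_snd).
- apply: (measurableT_comp (measurable_tnth i)).
  exact: (measurableT_comp measurable_snd measurable_snd).
- exact: (measurableT_comp (measurable_tnth i) measurable_fst).
Qed.

Lemma measurable_conch_pvalue (R : realType) (n t : nat)
    (S : nat -> n.-tuple E -> R) :
  measurable_fun [set: n.-tuple E] (S t) ->
  measurable_fun [set: n.-tuple E] (conch_pvalue S t).
Proof.
move=> mS; apply: measurable_funM; first exact: measurable_cst.
rewrite (_ : (fun x => _) = fun x => \sum_(p <- enum (split_perms n t))
    ((S t (permute p x) <= S t x)%R : nat)%:R); last first.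
  by apply/funext => x; rewrite big_enum.
apply: measurable_sum => p.
rewrite (_ : (fun x => _) =
    (fun x => if S t (permute p x) <= S t x then 1 else 0 : R)).
  apply: measurable_fun_ifT; [|exact: measurable_cst..].
  apply: measurable_fun_ler => //.
  exact: (measurableT_comp mS (measurable_permute p)).
by apply/funext => x; case: (_ <= _).
Qed.

(** Measurability of the identity out of the sigma-algebra generated by [G] puts every measurable
    set in [<<s G>>]. In a product it can be checked one coordinate at a time. *)
Lemma measurable_generated (G : set (set E)) :
  G `<=` measurable ->
  measurable_fun [set: g_sigma_algebraType G] (idfun : _ -> E) ->
  @measurable _ E = <<s G >>.
Proof.
move=> Gm mid; apply/seteqP; split => A.
  by move=> mA; have := mid measurableT A mA; rewrite setTI preimage_id.
by apply: smallest_sub => //; exact: sigma_algebra_measurable.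
Qed.

End measurability.

(** * Equality in law, independence and i.i.d. tuples *)

Section laws.
Context d (Om : measurableType d) (R : realType) (P : probability Om R).

(** Uniqueness of finite measures that agree on a generating pi-system, applied to the distributions
    of [U] and [V]. *)
Lemma eq_in_law_setI d' (E : measurableType d') (U V : Om -> E)
    (G : set (set E)) :
  measurable_fun setT U -> measurable_fun setT V ->
  @measurable _ E = <<s G >> -> setI_closed G -> G setT ->
  (forall A, G A -> P (U @^-1` A) = P (V @^-1` A)) ->
  eq_in_law P U V.
Proof.
move=> mU mV GE GI GT UV A mA.
pose U' : {mfun Om >-> E} := HB.pack U (@isMeasurableFun.Build _ _ _ _ U mU).
pose V' : {mfun Om >-> E} := HB.pack V (@isMeasurableFun.Build _ _ _ _ V mV).
(* The constant sequence [setT], of finite measure, serves as the exhaustion of the space. *)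
apply: (@measure_unique _ _ _ G (fun=> setT) GE GI _ _
  (distribution P U') (distribution P V')) => //.
- by rewrite bigcup_const//; exists 0%N.
- move=> _.
  have := probability_le1 (distribution P U') measurableT.
  by move=> /le_lt_trans; apply; exact: ltry.
Qed.

Lemma eq_in_law_comp d1 d2 (E1 : measurableType d1) (E2 : measurableType d2)
    (U V : Om -> E1) (f : E1 -> E2) :
  measurable_fun setT f -> eq_in_law P U V -> eq_in_law P (f \o U) (f \o V).
Proof.
move=> mf UV A mA; apply: (UV (f @^-1` A)).
by rewrite -[X in measurable X]setTI; exact: mf.
Qed.

(** On measurable rectangles independence factors both joint laws into equal marginals, and
    rectangles form a pi-system generating the product sigma-algebra. *)
Lemma eq_in_law_independent3 d1 d2 d3 (E1 : measurableType d1)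
    (E2 : measurableType d2) (E3 : measurableType d3)
    (U1 V1 : Om -> E1) (U2 V2 : Om -> E2) (U3 V3 : Om -> E3) :
  measurable_fun setT U1 -> measurable_fun setT V1 ->
  measurable_fun setT U2 -> measurable_fun setT V2 ->
  measurable_fun setT U3 -> measurable_fun setT V3 ->
  independent3 P U1 U2 U3 -> independent3 P V1 V2 V3 ->
  eq_in_law P U1 V1 -> eq_in_law P U2 V2 -> eq_in_law P U3 V3 ->
  eq_in_law P (fun w => (U1 w, (U2 w, U3 w))) (fun w => (V1 w, (V2 w, V3 w))).
Proof.
move=> mU1 mV1 mU2 mV2 mU3 mV3 indU indV UV1 UV2 UV3.
pose G : set (set (E1 * (E2 * E3))) := [set D | exists A B C,
  [/\ measurable A, measurable B, measurable C & D = A `*` (B `*` C)]].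
have GmkE A B C : measurable A -> measurable B -> measurable C ->
  <<s G >> (A `*` (B `*` C)).
  by move=> mA mB mC; apply: sub_sigma_algebra; exists A, B, C.
apply: (@eq_in_law_setI _ _ _ _ G).
- by apply: measurable_fun_pair => //; exact: measurable_fun_pair.
- by apply: measurable_fun_pair => //; exact: measurable_fun_pair.
- apply: measurable_generated.
    move=> _ [A [B [C [mA mB mC ->]]]].
    by apply: measurableX => //; exact: measurableX.
  (* The identity is rebuilt from the three projections; the preimage of [A] under each is a
     rectangle whose other sides are [setT]. *)
  rewrite (_ : idfun = fun x => (x.1, (x.2.1, x.2.2))); last first.
    by apply/funext => -[? []].
  apply: measurable_fun_pair; last apply: measurable_fun_pair.
  + move=> _ A mA; rewrite setTI (_ : _ @^-1` _ = A `*` (setT `*` setT)).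
      exact: GmkE.
    by apply/seteqP; split => [[? []]|[? []]]//= ? ? [].
  + move=> _ A mA; rewrite setTI (_ : _ @^-1` _ = setT `*` (A `*` setT)).
      exact: GmkE.
    by apply/seteqP; split => [[? []]|[? []]]//= ? ? [] ? [].
  + move=> _ A mA; rewrite setTI (_ : _ @^-1` _ = setT `*` (setT `*` A)).
      exact: GmkE.
    by apply/seteqP; split => [[? []]|[? []]]//= ? ? [] ? [].
- move=> _ _ [A [B [C [mA mB mC ->]]]] [A' [B' [C' [mA' mB' mC' ->]]]].
  exists (A `&` A'), (B `&` B'), (C `&` C'); split; [exact: measurableI..|].
  by rewrite -!setXI.
- by exists setT, setT, setT; split => //; rewrite !setXTT.
- move=> _ [A [B [C [mA mB mC ->]]]].
  have rect (W1 : Om -> E1) (W2 : Om -> E2) (W3 : Om -> E3) :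
      (fun w => (W1 w, (W2 w, W3 w))) @^-1` (A `*` (B `*` C)) =
      W1 @^-1` A `&` W2 @^-1` B `&` W3 @^-1` C.
    by apply/seteqP; split => w /= [] => [? []|[]].
  by rewrite !rect indU// indV// UV1// UV2// UV3.
Qed.

Lemma independent3_comp d1 d2 d3 d1' d2' d3'
    (E1 : measurableType d1) (E2 : measurableType d2) (E3 : measurableType d3)
    (F1 : measurableType d1') (F2 : measurableType d2')
    (F3 : measurableType d3')
    (U1 : Om -> E1) (U2 : Om -> E2) (U3 : Om -> E3)
    (f1 : E1 -> F1) (f2 : E2 -> F2) (f3 : E3 -> F3) :
  measurable_fun setT f1 -> measurable_fun setT f2 -> measurable_fun setT f3 ->
  independent3 P U1 U2 U3 -> independent3 P (f1 \o U1) (f2 \o U2) (f3 \o U3).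
Proof.
move=> mf1 mf2 mf3 ind A B C mA mB mC.
by apply: (ind (f1 @^-1` A) (f2 @^-1` B) (f3 @^-1` C));
  rewrite -[X in measurable X]setTI; [exact: mf1|exact: mf2|exact: mf3].
Qed.

Section tuples.
Context d' (E : measurableType d') (mu : probability E R) (n : nat).

Lemma iid_bigcap (V : Om -> n.-tuple E) (A : 'I_n -> set E) :
  iid P mu V -> (forall i, measurable (A i)) ->
  P (\bigcap_(i in [set: 'I_n]) [set w | A i (tnth (V w) i)]) =
  (\prod_(i < n) mu (A i))%E.
Proof.
by move=> [ind law] mA; rewrite ind//; apply: eq_bigr => i _; rewrite law.
Qed.

Lemma iid_permute (V : Om -> n.-tuple E) (p : 'S_n) :
  iid P mu V -> iid P mu (permute p \o V).
Proof.
move=> iidV; have law i (A : set E) : measurable A ->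
    P [set w | A (tnth ((permute p \o V) w) i)] = mu A.
  move=> mA; rewrite -(iidV.2 (p i) A mA); congr (P _).
  by apply/seteqP; split => w /=; rewrite tnth_mktuple.
split=> // A mA; rewrite (eq_bigr _ (fun i _ => law i _ (mA i))).
(* Position [i] after permuting is position [p i] of [V], so the side constraining position [j] of
   [V] is [A (p^-1 j)]. *)
rewrite (reindex_inj (@perm_inj _ p^-1%g)) /=.
rewrite -(iid_bigcap (A := fun i => A (p^-1%g i)) iidV)//; congr (P _).
apply/seteqP; split => w /= Aw i _ /=.
  by have := Aw (p^-1%g i) I; rewrite /= tnth_mktuple permKV.
by have := Aw (p i) I; rewrite /= tnth_mktuple permK.
Qed.

(** Both laws give a box the product of the [mu]-measures of its sides, and boxes form a generating
    pi-system. *)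
Lemma eq_in_law_iid (U V : Om -> n.-tuple E) :
  measurable_fun setT U -> measurable_fun setT V ->
  iid P mu U -> iid P mu V -> eq_in_law P U V.
Proof.
move=> mU mV iidU iidV.
pose box (A : 'I_n -> set E) := [set x : n.-tuple E | forall i, A i (tnth x i)].
pose G : set (set (n.-tuple E)) :=
  [set box A | A in [set A | forall i, measurable (A i)]].
have preimage_box T (W : T -> n.-tuple E) A :
    W @^-1` box A = \bigcap_(i in [set: 'I_n]) [set w | A i (tnth (W w) i)].
  by apply/seteqP; split => w /= Aw i; [move=> _|]; exact: Aw.
apply: (@eq_in_law_setI _ _ _ _ G) => //.
- apply: measurable_generated.
    move=> _ [A mA <-].
    have := preimage_box _ id A; rewrite preimage_id => ->.
    apply: fin_bigcap_measurable => // i _.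
    by rewrite -[X in measurable X]setTI; exact: (measurable_tnth i).
  apply/measurable_fun_tnthP => i _ A mA; rewrite setTI.
  (* A condition on coordinate [i] alone is a box with all other sides [setT]. *)
  apply: sub_sigma_algebra; exists (fun j => if j == i then A else setT).
    by move=> j; case: ifP.
  apply/seteqP; split => x /=; first by move/(_ i); rewrite eqxx.
  by move=> Ax j; case: eqP => // ->.
- move=> _ _ [A mA <-] [B mB <-]; exists (fun i => A i `&` B i).
    by move=> i; exact: measurableI.
  apply/seteqP; split => x /=; last by move=> [xA xB] i.
  by move=> AB; split => i; have [] := AB i.
- by exists (fun=> setT) => //; apply/seteqP; split.
- by move=> _ [A mA <-]; rewrite !preimage_box !iid_bigcap.
Qed.

End tuples.
End laws.

(** * Cutting at [xi], rejoining, and invariance under split permutations *)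

Section segments.
Variables n xi : nat.

Lemma size_segments : (minn xi n + (n - xi))%N = n.
Proof. by lia. Qed.

Let inl_pos (j : 'I_(minn xi n)) : 'I_n := cast_ord size_segments (lshift _ j).
Let inr_pos (j : 'I_(n - xi)) : 'I_n := cast_ord size_segments (rshift _ j).

Let inr_posE (j : 'I_(n - xi)) : inr_pos j = (xi + j)%N :> nat.
Proof.
(* The mere existence of [j] below [n - xi] forces [xi < n], so the minimum is [xi]. *)
rewrite /=; congr addn; apply/minn_idPl/ltnW.
by rewrite -subn_gt0; exact: leq_ltn_trans (ltn_ord j).
Qed.

Let tnth_segment1 T (x : n.-tuple T) j :
  tnth (segments xi x).1 j = tnth x (inl_pos j).
Proof.
(* The position [j] itself supplies an element of [T] as default value for [nth]. *)
have x0 : T := tnth x (inl_pos j); rewrite !(tnth_nth x0) /= nth_take//.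
by rewrite (leq_trans (ltn_ord j))// geq_minl.
Qed.

Let tnth_segment2 T (x : n.-tuple T) j :
  tnth (segments xi x).2 j = tnth x (inr_pos j).
Proof.
have x0 : T := tnth x (inr_pos j).
by rewrite !(tnth_nth x0) inr_posE /= nth_drop.
Qed.

(** Concatenation, written position by position so that the length is [n] itself rather than the sum
    in [size_segments]. *)
Definition join_segments T (u : (minn xi n).-tuple T * (n - xi).-tuple T) :
    n.-tuple T :=
  [tuple match fintype.split (cast_ord (esym size_segments) i) with
         | inl j => tnth u.1 j
         | inr j => tnth u.2 j
         end | i < n].

Let tnth_join1 T (u : (minn xi n).-tuple T * (n - xi).-tuple T) j :
  tnth (join_segments u) (inl_pos j) = tnth u.1 j.
Proof. by rewrite tnth_mktuple cast_ordK (unsplitK (inl j)). Qed.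

Let tnth_join2 T (u : (minn xi n).-tuple T * (n - xi).-tuple T) j :
  tnth (join_segments u) (inr_pos j) = tnth u.2 j.
Proof. by rewrite tnth_mktuple cast_ordK (unsplitK (inr j)). Qed.

Let pos_ind (Q : 'I_n -> Prop) :
  (forall j, Q (inl_pos j)) -> (forall j, Q (inr_pos j)) -> forall i, Q i.
Proof.
move=> Ql Qr i; rewrite -(cast_ordKV size_segments i).
case: (split_ordP (cast_ord (esym size_segments) i)) => j ->.
  exact: Ql.
exact: Qr.
Qed.

Lemma segmentsK T : cancel (@segments T n xi) (@join_segments T).
Proof.
move=> x; apply: eq_from_tnth; apply: pos_ind => j.
  by rewrite tnth_join1 tnth_segment1.
by rewrite tnth_join2 tnth_segment2.
Qed.

(** A split permutation maps each block of positions into itself; its restrictions, renumbered from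
    0 in each block, are injective and so give [p0] and [p1]. *)
Lemma split_perm_segments (p : 'S_n) : p \in split_perms n xi ->
  exists p0 p1, forall T (x : n.-tuple T),
    join_segments (permute p0 (segments xi x).1, permute p1 (segments xi x).2)
    = permute p x.
Proof.
move=> /split_permsP pxi.
have ltl j : (p (inl_pos j) < minn xi n)%N.
  by rewrite leq_min pxi ltn_ord andbT (leq_trans (ltn_ord j))// geq_minl.
have lel j : (xi <= p (inr_pos j))%N.
  by rewrite leqNgt pxi -leqNgt inr_posE leq_addr.
have ltr j : (p (inr_pos j) - xi < n - xi)%N by rewrite ltn_sub2rE// lel.
have pl j : p (inl_pos j) = inl_pos (Ordinal (ltl j)) by exact/val_inj.
have pr j : p (inr_pos j) = inr_pos (Ordinal (ltr j)).
  by apply/val_inj; rewrite [RHS]inr_posE /= subnKC.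
have injl : injective (fun j => Ordinal (ltl j)).
  move=> j k /(congr1 inl_pos); rewrite -!pl => /perm_inj.
  by move/cast_ord_inj/lshift_inj.
have injr : injective (fun j => Ordinal (ltr j)).
  move=> j k /(congr1 inr_pos); rewrite -!pr => /perm_inj.
  by move/cast_ord_inj/rshift_inj.
exists (perm injl), (perm injr) => T x.
apply: eq_from_tnth; apply: pos_ind => j.
  by rewrite tnth_join1 !tnth_mktuple permE tnth_segment1 -pl.
by rewrite tnth_join2 !tnth_mktuple permE tnth_segment2 -pr.
Qed.

Lemma measurable_join_segments d (E : measurableType d) :
  measurable_fun setT (@join_segments E).
Proof.
apply/measurable_fun_tnthP; apply: pos_ind => j.
  rewrite (_ : _ \o _ = @tnth _ E ^~ j \o fst).
    exact: (measurableT_comp (measurable_tnth j) measurable_fst).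
  by apply/funext => u; rewrite /= tnth_join1.
rewrite (_ : _ \o _ = @tnth _ E ^~ j \o snd).
  exact: (measurableT_comp (measurable_tnth j) measurable_snd).
by apply/funext => u; rewrite /= tnth_join2.
Qed.

End segments.

(** The joint equality in law of the two segments is pushed forward by [join_segments], which
    restores [X] on one side and gives [permute p] of it on the other. *)
Lemma split_exchangeable_permute d d' (Om : measurableType d)
    (E : measurableType d') (R : realType) (P : probability Om R) (n xi : nat)
    (X : Om -> n.-tuple E) (p : 'S_n) :
  split_exchangeable P xi X -> p \in split_perms n xi ->
  eq_in_law P X (permute p \o X).
Proof.
move=> exX /split_perm_segments[p0 [p1 pE]].
move=> A mA.
have := eq_in_law_comp (@measurable_join_segments n xi _ E) (exX p0 p1) mA.
set U := (X in P X = _ -> _); set V := (X in _ = P X -> _).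
have -> : U = X @^-1` A by apply/seteqP; split => w; rewrite /U /= segmentsK.
suff -> : V = (permute p \o X) @^-1` A by [].
by apply/seteqP; split => w; rewrite /V /= pE.
Qed.

(** * Superuniformity of the p-value, and coverage *)

Lemma conch_pvalue_superuniform d d' (Om : measurableType d)
    (E : measurableType d') (R : realType) (P : probability Om R) (n t : nat)
    (S : nat -> n.-tuple E -> R) (alpha : R) (X : Om -> n.-tuple E) :
  0 <= alpha -> measurable_fun setT (S t) -> measurable_fun setT X ->
  (forall p, p \in split_perms n t -> eq_in_law P X (permute p \o X)) ->
  (P [set w | (conch_pvalue S t (X w) <= alpha)%R] <= alpha%:E)%E.
Proof.
move=> a0 mS mX XpX; set G := split_perms n t.
pose B := [set x | conch_pvalue S t x <= alpha].
have mB : measurable B.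
  have := measurable_fun_ler (measurable_conch_pvalue mS)
    (measurable_cst alpha).
  by move=> /(_ measurableT [set true] I); rewrite setTI.
have mpX p : measurable ((permute p \o X) @^-1` B).
  have mp : measurable_fun setT (permute p \o X).
    exact: measurableT_comp (measurable_permute p) mX.
  by rewrite -[X in measurable X]setTI; exact: mp.
have G0 : 0 < #|G|%:R :> R.
  by rewrite ltr0n; apply/card_gt0P; exists 1%g; exact: split_perms1.
(* By invariance in law, each [permute p \o X] falls in [B] with the same probability as [X]; the
   integral is the expected number of [p] for which it does. *)
have sumE : (#|G|%:R%:E * P (X @^-1` B) =
    \int[P]_w \sum_(p <- enum G) (\1_((permute p \o X) @^-1` B) w)%:E)%E.
  rewrite ge0_integral_sum//; last first.
    by move=> p; apply/measurable_EFinP; exact: measurable_indic.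
  rewrite big_enum /= (eq_bigr (fun=> P (X @^-1` B))) => [|p pG]; last first.
    by rewrite integral_indic// setIT (XpX p pG).
  have mXB : measurable (X @^-1` B).
    by rewrite -[X in measurable X]setTI; exact: mX.
  rewrite -(fineK (fin_num_measure P _ mXB)) sumEFin sumr_const -EFinM.
  by rewrite mulr_natl.
rewrite -(@lee_pmul2l _ #|G|%:R%:E) ?lte_fin//.
rewrite [leLHS]sumE.
(* With the bound written as the integral of a constant, it remains to compare integrands, which is
   [sum_conch_pvalue_le] at each outcome. *)
have -> : (#|G|%:R%:E * alpha%:E = \int[P]_w (alpha * #|G|%:R)%:E)%E.
  by rewrite integral_cst//= probability_setT mule1 -EFinM mulrC.
apply: ge0_le_integral => //.
- by move=> w _; apply: sume_ge0.
- apply: emeasurable_sum => p; apply/measurable_EFinP; exact: measurable_indic.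
move=> w _; rewrite sumEFin lee_fin big_enum.
apply: le_trans (sum_conch_pvalue_le t S (X w) a0).
by apply: ler_sum => p _; rewrite indicE mem_setE.
Qed.

Theorem lemma2 (d d' : measure_display) (Om : measurableType d)
  (E : measurableType d') (R : realType) (P : probability Om R)
  (n xi : nat) (alpha eps : R) (Q : probability E R)
  (Xt : {RV P >-> n.-tuple E}) (Y : {RV P >-> n.-tuple bool})
  (Z : {RV P >-> n.-tuple E}) (S : nat -> n.-tuple E -> R)
  (hn : (2 <= n)%N) (hxi : (1 <= xi <= n.-1)%N)
  (halpha : 0 < alpha < 1) (heps : 0 < eps < 1)
  (hXt : split_exchangeable P xi Xt)
  (hY : iid P (bernoulli_prob eps) Y)
  (hZ : iid P Q Z)
  (hindep : independent3 P Xt Y Z)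
  (hS : forall t : nat, (1 <= t <= n.-1)%N ->
     measurable_fun [set: n.-tuple E] (S t)) :
  ((1 - alpha)%:E <=
   P [set w | xi \in conch_set S alpha (contaminate (Xt w) (Y w) (Z w))])%E.
Proof.
case/andP: halpha => a0 _.
have mS := hS xi hxi; have xi_bnd : (0 < xi < n)%N by lia.
pose X w := contaminate (Xt w) (Y w) (Z w).
have mcomp d1 (T : measurableType d1) (U : {RV P >-> n.-tuple T}) p :
    measurable_fun setT (permute p \o U).
  exact: measurableT_comp (measurable_permute p) _.
have mX : measurable_fun setT X.
  have mXYZ : measurable_fun setT (fun w => (Xt w, (Y w, Z w))).
    by apply: measurable_fun_pair => //; exact: measurable_fun_pair.
  exact: measurableT_comp (@measurable_contaminate _ E n) mXYZ.
have XpX p : p \in split_perms n xi -> eq_in_law P X (permute p \o X).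
  move=> pxi.
  (* Moving [permute p] inside [contaminate] presents both laws as images, under one measurable map,
     of laws of independent triples. *)
  have -> : permute p \o X = (fun w => contaminate w.1 w.2.1 w.2.2) \o
      (fun w => ((permute p \o Xt) w,
                 ((permute p \o Y) w, (permute p \o Z) w))).
    by apply/funext => w /=; rewrite permute_contaminate.
  apply: (@eq_in_law_comp _ _ _ _ _ _ _ _ (fun w => (Xt w, (Y w, Z w)))).
    exact: measurable_contaminate.
  apply: (eq_in_law_independent3 _ (mcomp _ _ Xt p) _ (mcomp _ _ Y p) _
    (mcomp _ _ Z p) hindep) => //.
  - exact: (independent3_comp (@measurable_permute _ E n p)
      (@measurable_permute _ bool n p) (@measurable_permute _ E n p) hindep).
  - exact: split_exchangeable_permute.
  - by apply: eq_in_law_iid hY (iid_permute p hY).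
  - by apply: eq_in_law_iid hZ (iid_permute p hZ).
have mB : measurable [set w | conch_pvalue S xi (X w) <= alpha].
  have := measurable_fun_ler (measurableT_comp (measurable_conch_pvalue mS) mX)
    (measurable_cst alpha).
  by move=> /(_ measurableT [set true] I); rewrite setTI.
(* Since [xi] lies in the admissible range, missing it means exactly that its p-value is at most
   [alpha]. *)
have -> : [set w | xi \in conch_set S alpha (X w)] =
    ~` [set w | conch_pvalue S xi (X w) <= alpha].
  apply/seteqP; split => w; rewrite /= in_setE.
    by move=> [_]; rewrite ltNge => /negP.
  by move=> /negP; rewrite -ltNge => ?; split.
rewrite probability_setC// EFinB leeD2l// leeN2.
exact: conch_pvalue_superuniform (ltW a0) mS mX XpX.
Qed.
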